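(* Let $(N_n)_{n\in\mathbb{Z}}$ be the Narayana sequence extended to all integers: $N_0=0$, $N_1=1$, $N_2=1$ and $N_n=N_{n-1}+N_{n-3}$ for all integers $n$. Then for every integer $n\ge 1$: (a) $\sum_{k=1}^{n}N_{-k}=-2N_{-n-1}-N_{-n-2}-N_{-n-3}+1.$ (b) $\sum_{k=1}^{n}N_{-2k}=\frac{1}{3}\left(-2N_{-2n+1}+N_{-2n}-N_{-2n-1}+2\right).$ (c) $\sum_{k=1}^{n}N_{-2k+1}=\frac{1}{3}\left(-N_{-2n+1}-N_{-2n}-2N_{-2n-1}+1\right).$ *)

(* Defs.v *)
From mathcomp Require Import all_boot all_order all_algebra.
From mathcomp Require Import zify ring.

Set Implicit Arguments.
Unset Strict Implicit.
Unset Printing Implicit Defensive.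

Import GRing.Theory.
Local Open Scope ring_scope.

Record narayana_sequence (N : int -> int) : Prop := NarayanaSequence {
  narayana0 : N 0 = 0;
  narayana1 : N 1 = 1;
  narayana2 : N 2 = 1;
  narayana_rec : forall n : int, N n = N (n - 1) + N (n - 3)
}.

(* The conditions above determine exactly one sequence. *)

(* The window (N_n, N_{n+1}, N_{n+2}) moved one index forward or backward. *)
Definition narayana_next (s : int * int * int) : int * int * int :=
  let: (a, b, c) := s in (b, c, c + a).
Definition narayana_prev (s : int * int * int) : int * int * int :=
  let: (a, b, c) := s in (c - b, a, b).

Definition narayana_window (n : int) : int * int * int :=
  match n with
  | Posz m => iter m narayana_next (0, 1, 1)
  | Negz m => iter m.+1 narayana_prev (0, 1, 1)
  end.
Definition narayana (n : int) : int := (narayana_window n).1.1.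

Lemma narayana_windowS (n : int) :
  narayana_window (n + 1) = narayana_next (narayana_window n).
Proof.
have prevK s : narayana_next (narayana_prev s) = s.
  by case: s => [[a b] c] /=; congr (_, _, _); ring.
case: n => [m|[|m]].
- by rewrite -PoszD addn1.
- by rewrite (_ : Negz 0 + 1 = 0) //= prevK.
- rewrite (_ : Negz m.+1 + 1 = Negz m); last by lia.
  by rewrite [in RHS]/narayana_window iterS prevK.
Qed.

Lemma narayanaP : narayana_sequence narayana.
Proof.
split=> // n; rewrite /narayana.
have e2 : n - 2 = (n - 3) + 1 by lia.
have e1 : n - 1 = (n - 3) + 1 + 1 by lia.
have e0 : n = (n - 3) + 1 + 1 + 1 by lia.
rewrite e1 [in LHS]e0 !narayana_windowS.
by case: (narayana_window _) => [[a b] c].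
Qed.

Lemma narayana_unique (N M : int -> int) :
  narayana_sequence N -> narayana_sequence M -> N =1 M.
Proof.
move=> [N0 N1 N2 NS] [M0 M1 M2 MS] z.
have fwd m : [/\ N m%:Z = M m%:Z, N (m%:Z + 1) = M (m%:Z + 1)
                & N (m%:Z + 2) = M (m%:Z + 2)].
  elim: m => [|m [E0 E1 E2]]; first by rewrite !add0r N0 N1 N2 M0 M1 M2.
  rewrite (_ : m.+1%:Z = m%:Z + 1); last by lia.
  rewrite (_ : m%:Z + 1 + 1 = m%:Z + 2); last by lia.
  split=> //; rewrite NS MS.
  rewrite (_ : m%:Z + 1 + 2 - 1 = m%:Z + 2); last by lia.
  by rewrite (_ : m%:Z + 1 + 2 - 3 = m%:Z) ?E0 ?E2 //; lia.
have bwd m : [/\ N (- m%:Z) = M (- m%:Z), N (- m%:Z + 1) = M (- m%:Z + 1)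
                & N (- m%:Z + 2) = M (- m%:Z + 2)].
  elim: m => [|m [E0 E1 E2]]; first by rewrite oppr0 !add0r N0 N1 N2 M0 M1 M2.
  rewrite (_ : - m.+1%:Z = - m%:Z - 1); last by lia.
  rewrite (_ : - m%:Z - 1 + 1 = - m%:Z); last by lia.
  rewrite (_ : - m%:Z - 1 + 2 = - m%:Z + 1); last by lia.
  split=> //; have := NS (- m%:Z + 2); have := MS (- m%:Z + 2).
  rewrite (_ : - m%:Z + 2 - 1 = - m%:Z + 1); last by lia.
  rewrite (_ : - m%:Z + 2 - 3 = - m%:Z - 1); last by lia.
  by rewrite E1 E2 => -> /addrI.
case: z => m; first by case: (fwd m).
by rewrite NegzE; case: (bwd m.+1).
Qed.

(* Main.v *)
Require Import Defs.
From mathcomp Require Import all_boot all_order all_algebra.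
From mathcomp Require Import zify ring.

Set Implicit Arguments.
Unset Strict Implicit.
Unset Printing Implicit Defensive.

Import GRing.Theory.
Local Open Scope ring_scope.

(* Each right-hand side vanishes at [n = 0], since [N_1 = 1] and
   [N_0 = N_(-1) = N_(-3) = 0], [N_(-2) = 1]; and its increment from [n] to
   [n + 1] is the next summand (three times it, in (b) and (c)) by the
   recurrence at one or two indices. So each sum telescopes. *)

Lemma telescope_sum1 (V : zmodType) (f G : nat -> V) (n : nat) :
  G 0%N = 0 -> (forall k, G k.+1 = G k + f k.+1) ->
  \sum_(1 <= k < n.+1) f k = G n.
Proof.
move=> G0 GS; elim: n => [|n IHn]; first by rewrite big_geq.
by rewrite big_nat_recr //= IHn GS.
Qed.

(** Parts (b) and (c) are proved over [int] with the factor 3 cleared; this carries them to [rat],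
    where dividing by 3 makes sense. *)
Lemma eq_ratr_third (x y : int) :
  3 * x = y -> x%:~R = 1 / 3 * y%:~R :> rat.
Proof. by move=> <-; rewrite rmorphM /=; field. Qed.

Section NarayanaSums.

Variables (N : int -> int) (hN : narayana_sequence N).

(** [rec4], [rec3] and [rec2] are shifts of one recurrence, named after the lowest offset from [m],
    with indices normalised for rewriting. *)
Let rec4 (m : int) : N (m - 1) = N (m - 2) + N (m - 4).
Proof.
rewrite (narayana_rec hN (m - 1)).
by congr (N _ + N _); lia.
Qed.

Let rec3 (m : int) : N m = N (m - 1) + N (m - 3).
Proof. exact: narayana_rec. Qed.

Let rec2 (m : int) : N (m + 1) = N m + N (m - 2).
Proof.
rewrite (narayana_rec hN (m + 1)).
by congr (N _ + N _); lia.
Qed.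

Lemma narayanaN1 : N (- 1) = 0.
Proof.
(* The closed indices [2 - 1] and [2 - 3] compute, so the recurrence run backwards has this form by
   conversion. *)
have : N 2 = N 1 + N (- 1) := rec3 2.
by rewrite (narayana1 hN) (narayana2 hN); lia.
Qed.

Lemma narayanaN2 : N (- 2) = 1.
Proof.
have : N 1 = N 0 + N (- 2) := rec3 1.
by rewrite (narayana0 hN) (narayana1 hN); lia.
Qed.

Lemma narayanaN3 : N (- 3) = 0.
Proof.
have : N 0 = N (- 1) + N (- 3) := rec3 0.
by rewrite (narayana0 hN) narayanaN1; lia.
Qed.

Lemma sum_narayanaN (n : nat) :
  \sum_(1 <= k < n.+1) N (- k%:Z)
    = - 2 * N (- n%:Z - 1) - N (- n%:Z - 2) - N (- n%:Z - 3) + 1.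
Proof.
(* The right-hand side as a function of [m = - n]. *)
pose G (m : int) : int := - 2 * N (m - 1) - N (m - 2) - N (m - 3) + 1.
apply: (telescope_sum1 (G := fun k => G (- k%:Z))) => [|k]; rewrite /G.
  by rewrite oppr0 !add0r narayanaN1 narayanaN2 narayanaN3.
set m := - k%:Z; have -> : - k.+1%:Z = m - 1 by rewrite /m; lia.
have -> : m - 1 - 1 = m - 2 by lia.
have -> : m - 1 - 2 = m - 3 by lia.
have -> : m - 1 - 3 = m - 4 by lia.
by rewrite (rec4 m); ring.
Qed.

Lemma sum_narayanaN_even (n : nat) :
  3 * (\sum_(1 <= k < n.+1) N (- (2 * k%:Z)))
    = - 2 * N (- (2 * n%:Z) + 1) + N (- (2 * n%:Z)) - N (- (2 * n%:Z) - 1) + 2.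
Proof.
pose G (m : int) : int := - 2 * N (m + 1) + N m - N (m - 1) + 2.
rewrite mulr_sumr.
apply: (telescope_sum1 (G := fun k => G (- (2 * k%:Z)))) => [|k]; rewrite /G.
  by rewrite mulr0 oppr0 !add0r (narayana1 hN) (narayana0 hN) narayanaN1.
set m := - (2 * k%:Z); have -> : - (2 * k.+1%:Z) = m - 2 by rewrite /m; lia.
have -> : m - 2 + 1 = m - 1 by lia.
have -> : m - 2 - 1 = m - 3 by lia.
(* The order matters: [rec2] creates a further [N m], which [rec3] then eliminates, leaving only
   indices [m - 1], [m - 2] and [m - 3]. *)
by rewrite (rec2 m) (rec3 m); ring.
Qed.

Lemma sum_narayanaN_odd (n : nat) :
  3 * (\sum_(1 <= k < n.+1) N (- (2 * k%:Z) + 1))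
    = - N (- (2 * n%:Z) + 1) - N (- (2 * n%:Z))
      - 2 * N (- (2 * n%:Z) - 1) + 1.
Proof.
pose G (m : int) : int := - N (m + 1) - N m - 2 * N (m - 1) + 1.
rewrite mulr_sumr.
apply: (telescope_sum1 (G := fun k => G (- (2 * k%:Z)))) => [|k]; rewrite /G.
  by rewrite mulr0 oppr0 !add0r (narayana1 hN) (narayana0 hN) narayanaN1.
set m := - (2 * k%:Z); have -> : - (2 * k.+1%:Z) = m - 2 by rewrite /m; lia.
(* This also turns the new summand into [N (m - 1)]. *)
have -> : m - 2 + 1 = m - 1 by lia.
have -> : m - 2 - 1 = m - 3 by lia.
by rewrite (rec2 m) (rec3 m); ring.
Qed.

End NarayanaSums.

Theorem corollary3p20 (N : int -> int) (hN : narayana_sequence N)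
    (n : nat) (hn : (1 <= n)%N) :
  [/\ \sum_(1 <= k < n.+1) N (- k%:Z)
        = - 2 * N (- n%:Z - 1) - N (- n%:Z - 2) - N (- n%:Z - 3) + 1,
      (\sum_(1 <= k < n.+1) N (- (2 * k%:Z)))%:~R
        = 1 / 3 * (- 2 * N (- (2 * n%:Z) + 1) + N (- (2 * n%:Z))
                   - N (- (2 * n%:Z) - 1) + 2)%:~R :> rat
    & (\sum_(1 <= k < n.+1) N (- (2 * k%:Z) + 1))%:~R
        = 1 / 3 * (- N (- (2 * n%:Z) + 1) - N (- (2 * n%:Z))
                   - 2 * N (- (2 * n%:Z) - 1) + 1)%:~R :> rat].
Proof.
split; first exact: sum_narayanaN.
- exact/eq_ratr_third/sum_narayanaN_even.
- exact/eq_ratr_third/sum_narayanaN_odd.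
Qed.
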